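(* For every real number $x\geq 1$, $$\sqrt{2\pi}\,x^xe^{-x}\left(x^2+\frac{x}{3}+a_*\right)^{\frac{1}{4}}\leq \Gamma(x+1)<\sqrt{2\pi}\,x^xe^{-x}\left(x^2+\frac{x}{3}+a^*\right)^{\frac{1}{4}},$$ where the constants $a_*=\frac{e^4}{4\pi^2}-\frac{4}{3}$ ($=0.049653963176\ldots$) and $a^*=\frac{1}{18}$ are the best possible; that is, $a_*$ is the largest real number for which the left-hand inequality holds for all $x\geq 1$, and $a^*$ is the smallest real number for which the right-hand inequality holds for all $x\geq 1$.
   Context: $\Gamma(x)=\int_0^\infty u^{x-1}e^{-u}\,du$ for real $x>0$ is the gamma function. *)

(* Defs.v *)
From Stdlib Require Import Reals.
From Coquelicot Require Import Coquelicot.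
Open Scope R_scope.

(* The integral is improper at both ends; it converges for x > 0, and the
   value of Gamma at other x is not meaningful. *)
Definition Gamma (x : R) : R :=
  RInt_gen (fun u => Rpower u (x - 1) * exp (- u))
    (at_right 0) (Rbar_locally p_infty).

(* Rpower y _ is the real power for y > 0 only (it is 1 for y <= 0).  For
   x >= 1 the base x^2 + x/3 + a is positive as soon as a > -4/3, which both
   constants below satisfy. *)
Definition stirling_approx (a x : R) : R :=
  sqrt (2 * PI) * Rpower x x * exp (- x) * Rpower (x ^ 2 + x / 3 + a) (1 / 4).

Definition a_lower : R := exp 4 / (4 * PI ^ 2) - 4 / 3.
Definition a_upper : R := 1 / 18.

Definition lower_bound_holds (a : R) : Prop :=
  forall x : R, 1 <= x -> stirling_approx a x <= Gamma (x + 1).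

Definition upper_bound_holds (a : R) : Prop :=
  forall x : R, 1 <= x -> Gamma (x + 1) < stirling_approx a x.

Definition is_largest (E : R -> Prop) (m : R) : Prop :=
  E m /\ forall a : R, E a -> a <= m.

Definition is_smallest (E : R -> Prop) (m : R) : Prop :=
  E m /\ forall a : R, E a -> m <= a.

(* Main.v *)
Require Import Defs.
From Stdlib Require Import Reals Lra Lia ZArith Machin.
From Coquelicot Require Import Coquelicot.
Open Scope R_scope.

(** Write [Gamma (x + 1) = exp (stirling_exponent x + phi x)], so that the claim
    compares [phi] with [q_a x = ln (1 + 1 / (3 x) + a / x ^ 2) / 4].  The
    increment [phi x - phi (x + 1) = (x + 1/2) ln (1 + 1/x) - 1] has the rational
    second derivative [1 / (2 x^2 (x + 1)^2)], and [phi (x + n)] tends to 0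
    (Wallis' product for integers, log-convexity of Gamma for reals).  Hence
    [g > 0] as soon as [g (x + n)] tends to 0 and [g x - g (x + 1)] has a positive
    second derivative, which turns [phi < q_(1/18)] and
    [1 / (12 x) - 1 / (360 x^3) < phi] into positivity of rational functions.
    The second bound makes [1/18] optimal and gives the lower inequality for
    [x >= 7/5].  On [[1, 7/5]] the function [phi - q_(a_lower)] is concave: the
    part [phi (x + 1) - 1 / (12 (x + 1))] is a sum of concave terms, the rest has
    an explicit second derivative.  It vanishes at 1 and is nonnegative at 7/5. *)

(** * Positivity and convexity by telescoping *)

Lemma mean_value (f f' : R -> R) (a b : R) :
  a < b -> (forall x, a <= x <= b -> is_derive f x (f' x)) ->
  exists c, f b - f a = f' c * (b - a) /\ a < c < b.
Proof.
  intros Hab Hf; apply MVT_cor2; auto.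
  intros c Hc; apply is_derive_Reals; auto.
Qed.

(** The mean value theorem turns the slopes over [[a, x]] and [[x, b]] into [f' c1] and [f' c2] with
    [c1 < c2], and [f'] increases between these points. The chord inequality is cleared of
    denominators. *)
Lemma strictly_convex_chord (f f' f'' : R -> R) (a x b : R) :
  a < x < b ->
  (forall y, a <= y <= b -> is_derive f y (f' y)) ->
  (forall y, a <= y <= b -> is_derive f' y (f'' y)) ->
  (forall y, a <= y <= b -> 0 < f'' y) ->
  (b - a) * f x < (b - x) * f a + (x - a) * f b.
Proof.
  intros Hx H1 H2 Hpos.
  destruct (mean_value f f' a x) as [c1 [E1 Hc1]]; [lra|intros; apply H1; lra|].
  destruct (mean_value f f' x b) as [c2 [E2 Hc2]]; [lra|intros; apply H1; lra|].
  destruct (mean_value f' f'' c1 c2) as [c [E Hc]]; [lra|intros; apply H2; lra|].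
  assert (Hlt : 0 < f' c2 - f' c1).
  { rewrite E; apply Rmult_lt_0_compat; [apply Hpos|]; lra. }
  assert (0 < (x - a) * (b - x) * (f' c2 - f' c1)).
  { apply Rmult_lt_0_compat; [apply Rmult_lt_0_compat; lra|lra]. }
  replace (f a) with (f x - f' c1 * (x - a)) by lra.
  replace (f b) with (f x + f' c2 * (b - x)) by lra.
  lra.
Qed.

Lemma vanishing_decreasing_ge0 (u : nat -> R) :
  is_lim_seq u 0 -> (forall n, u (S n) <= u n) -> forall n, 0 <= u n.
Proof. intros Hu Hd n; apply (is_lim_seq_decr_compare u 0 Hu Hd n). Qed.

Lemma vanishing_strictly_decreasing_gt0 (u : nat -> R) :
  is_lim_seq u 0 -> (forall n, u (S n) < u n) -> forall n, 0 < u n.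
Proof.
  intros Hu Hd n.
  apply Rle_lt_trans with (2 := Hd n), vanishing_decreasing_ge0; auto.
  intros k; apply Rlt_le, Hd.
Qed.

(** The differences [u n - u (S n)] tend to 0 and, by convexity, strictly decrease, so they are
    positive; then [u] itself strictly decreases to 0. *)
Lemma vanishing_convex_gt0 (u : nat -> R) :
  is_lim_seq u 0 -> (forall n, 2 * u (S n) < u n + u (S (S n))) ->
  forall n, 0 < u n.
Proof.
  intros Hu Hc; apply vanishing_strictly_decreasing_gt0; auto.
  intros n; apply Rlt_0_minus.
  apply (vanishing_strictly_decreasing_gt0 (fun n => u n - u (S n))).
  - replace (Finite 0) with (Finite (0 - 0)) by (f_equal; ring).
    apply is_lim_seq_minus'; [exact Hu|now apply is_lim_seq_incr_1 in Hu].
  - intros k; specialize (Hc k); lra.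
Qed.

(** Convexity only asks for the sign of the second derivative, so the first one stays
    existential. *)
Definition has_D2 (f f2 : R -> R) : Prop :=
  exists f1, forall x, 1 <= x -> is_derive f x (f1 x) /\ is_derive f1 x (f2 x).

Lemma has_D2_ext (f g f2 g2 : R -> R) :
  (forall x, 1 <= x -> f2 x = g2 x) -> (forall x, 0 < x -> f x = g x) ->
  has_D2 f f2 -> has_D2 g g2.
Proof.
  intros H2 H [f1 Hf]; exists f1; intros x Hx; destruct (Hf x Hx) as [A B].
  split; [|now rewrite <- H2].
  apply is_derive_ext_loc with f; [|exact A].
  apply (locally_interval _ x 0 p_infty); simpl; [lra|easy|auto].
Qed.

Lemma has_D2_minus (f g f2 g2 : R -> R) :
  has_D2 f f2 -> has_D2 g g2 ->
  has_D2 (fun x => f x - g x) (fun x => f2 x - g2 x).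
Proof.
  intros [f1 Hf] [g1 Hg]; exists (fun x => f1 x - g1 x); intros x Hx.
  split; apply (is_derive_minus (V := R_NormedModule)); now (apply Hf || apply Hg).
Qed.

Lemma has_D2_shift (f f2 : R -> R) :
  has_D2 f f2 -> has_D2 (fun x => f (x + 1)) (fun x => f2 (x + 1)).
Proof.
  intros [f1 Hf]; exists (fun x => f1 (x + 1)); intros x Hx.
  destruct (Hf (x + 1)) as [A B]; [lra|].
  assert (Hs : is_derive (fun y => y + 1) x 1) by (auto_derive; [easy|lra]).
  split.
  - replace (f1 (x + 1)) with (1 * f1 (x + 1)) by ring.
    now apply (is_derive_comp f (fun y => y + 1) x (f1 (x + 1)) 1).
  - replace (f2 (x + 1)) with (1 * f2 (x + 1)) by ring.
    now apply (is_derive_comp f1 (fun y => y + 1) x (f2 (x + 1)) 1).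
Qed.

(** Chords of [f] between points two apart show that [f (x + INR n)] is a convex sequence. *)
Lemma vanishing_D2_gt0 (f f2 : R -> R) (x : R) :
  1 <= x -> has_D2 f f2 -> (forall y, 1 <= y -> 0 < f2 y) ->
  is_lim_seq (fun n => f (x + INR n)) 0 -> 0 < f x.
Proof.
  intros Hx [f1 Hf] Hpos Hlim.
  replace x with (x + INR 0) by (simpl; ring).
  apply (vanishing_convex_gt0 (fun n => f (x + INR n))); auto.
  intros n; rewrite !S_INR; assert (Hn := pos_INR n).
  assert (H : (x + (INR n + 1 + 1) - (x + INR n)) * f (x + (INR n + 1)) <
    (x + (INR n + 1 + 1) - (x + (INR n + 1))) * f (x + INR n) +
    (x + (INR n + 1) - (x + INR n)) * f (x + (INR n + 1 + 1))).
  { apply strictly_convex_chord with f1 f2; try lra.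
    - intros y Hy; apply Hf; lra.
    - intros y Hy; apply Hf; lra.
    - intros y Hy; apply Hpos; lra. }
  lra.
Qed.

(* The increments are convex and tend to 0, hence positive, so [g] itself
   decreases to 0 along [x, x + 1, ...]. *)
Lemma vanishing_increment_D2_gt0 (g r2 : R -> R) (x : R) :
  1 <= x -> has_D2 (fun y => g y - g (y + 1)) r2 ->
  (forall y, 1 <= y -> 0 < r2 y) ->
  (forall y, 1 <= y -> is_lim_seq (fun n => g (y + INR n)) 0) -> 0 < g x.
Proof.
  intros Hx H2 Hpos Hlim.
  replace x with (x + INR 0) by (simpl; ring).
  apply (vanishing_strictly_decreasing_gt0 (fun n => g (x + INR n))); auto.
  intros n; rewrite S_INR, <- Rplus_assoc; apply Rlt_0_minus.
  assert (Hn := pos_INR n).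
  apply (vanishing_D2_gt0 (fun y => g y - g (y + 1)) r2 (x + INR n)); auto; [lra|].
  replace (Finite 0) with (Finite (0 - 0)) by (f_equal; ring).
  apply is_lim_seq_minus'; [apply Hlim; lra|].
  apply is_lim_seq_ext with (2 := Hlim (x + INR n + 1) ltac:(lra)).
  intros k; f_equal; ring.
Qed.

(** Such a [g] is the sum of its increments along unit shifts and inherits their convexity: the
    chord defect at the points shifted by [n] decreases to 0, hence is nonnegative at [n = 0]. *)
Lemma vanishing_increment_D2_chord (g r2 : R -> R) (a x b : R) :
  1 <= a -> a < x < b -> has_D2 (fun y => g y - g (y + 1)) r2 ->
  (forall y, 1 <= y -> 0 < r2 y) ->
  (forall y, 1 <= y -> is_lim_seq (fun n => g (y + INR n)) 0) ->
  (b - a) * g x <= (b - x) * g a + (x - a) * g b.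
Proof.
  intros Ha Hx [r1 Hr] Hpos Hlim; apply Rminus_le_0.
  set (u := fun n => (b - x) * g (a + INR n) + (x - a) * g (b + INR n)
                     - (b - a) * g (x + INR n)).
  enough (H : 0 <= u 0%nat) by (unfold u in H; simpl in H; rewrite !Rplus_0_r in H; exact H).
  apply vanishing_decreasing_ge0.
  - replace (Finite 0) with (Finite ((b - x) * 0 + (x - a) * 0 - (b - a) * 0))
      by (f_equal; ring).
    apply is_lim_seq_minus'; [apply is_lim_seq_plus'|].
    + apply (is_lim_seq_scal_l _ _ 0), Hlim; lra.
    + apply (is_lim_seq_scal_l _ _ 0), Hlim; lra.
    + apply (is_lim_seq_scal_l _ _ 0), Hlim; lra.
  - intros n; unfold u; rewrite S_INR, <- !Rplus_assoc; assert (Hn := pos_INR n).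
    assert (H := strictly_convex_chord (fun y => g y - g (y + 1)) r1 r2
      (a + INR n) (x + INR n) (b + INR n) ltac:(lra)
      ltac:(intros; apply Hr; lra) ltac:(intros; apply Hr; lra)
      ltac:(intros; apply Hpos; lra)).
    cbv beta in H.
    replace (b + INR n - (a + INR n)) with (b - a) in H by ring.
    replace (b + INR n - (x + INR n)) with (b - x) in H by ring.
    replace (x + INR n - (a + INR n)) with (x - a) in H by ring.
    lra.
Qed.

(** * The Gamma integral *)

Definition is_RInt_0_infty (f : R -> R) (l : R) : Prop :=
  is_RInt_gen f (at_right 0) (Rbar_locally p_infty) l.

(** Reduces eventual statements about the improper integral to intervals whose end points lie beyond
    prescribed ones. *)
Lemma eventually_inside (a b : R) : 0 < a ->
  filter_prod (at_right 0) (Rbar_locally p_infty)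
    (fun ab => 0 < fst ab < a /\ b < snd ab).
Proof.
  intros Ha.
  apply Filter_prod with (fun u => 0 < u < a) (fun u => b < u); [| |auto].
  - exists (mkposreal a Ha); intros u Hu Hpos; split; [exact Hpos|].
    change (Rabs (minus u 0) < a) in Hu; unfold minus, plus, opp in Hu; simpl in Hu.
    rewrite Ropp_0, Rplus_0_r in Hu; apply Rabs_def2 in Hu; lra.
  - exists b; auto.
Qed.

Lemma RInt_0_infty_ext (f g : R -> R) (l : R) :
  (forall u, 0 < u -> f u = g u) -> is_RInt_0_infty f l -> is_RInt_0_infty g l.
Proof.
  intros H; apply (is_RInt_gen_ext (V := R_NormedModule) f g l).
  apply filter_imp with (2 := eventually_inside 1 1 Rlt_0_1).
  intros [a b] [Ha Hb] x; simpl in *; rewrite Rmin_left by lra.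
  intros Hx; apply H; lra.
Qed.

Lemma RInt_0_infty_unique (f : R -> R) (l l' : R) :
  is_RInt_0_infty f l -> is_RInt_0_infty f l' -> l = l'.
Proof.
  intros H H'; rewrite <- (is_RInt_gen_unique (V := R_CompleteNormedModule) f l H).
  exact (is_RInt_gen_unique (V := R_CompleteNormedModule) f l' H').
Qed.

Lemma RInt_0_infty_lincomb (f g : R -> R) (a b lf lg : R) :
  is_RInt_0_infty f lf -> is_RInt_0_infty g lg ->
  is_RInt_0_infty (fun u => a * f u + b * g u) (a * lf + b * lg).
Proof.
  intros Hf Hg.
  exact (is_RInt_gen_plus (V := R_NormedModule) _ _ _ _
    (is_RInt_gen_scal (V := R_NormedModule) f a lf Hf)
    (is_RInt_gen_scal (V := R_NormedModule) g b lg Hg)).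
Qed.

(** With [f] as its own majorant, the norm bound for integrals reads [norm l <= l]. *)
Lemma RInt_0_infty_ge0 (f : R -> R) (l : R) :
  (forall u, 0 < u -> 0 <= f u) -> is_RInt_0_infty f l -> 0 <= l.
Proof.
  intros H Hl; apply Rle_trans with (norm l); [apply norm_ge_0|].
  apply (RInt_gen_norm f f l l) with (3 := Hl) (4 := Hl).
  - apply filter_imp with (2 := eventually_inside 1 1 Rlt_0_1).
    intros [a b]; simpl; lra.
  - apply filter_imp with (2 := eventually_inside 1 1 Rlt_0_1).
    intros [a b] Hab x Hx; simpl in *.
    change (Rabs (f x) <= f x); rewrite Rabs_pos_eq; [lra|apply H; lra].
Qed.

Lemma RInt_0_infty_le (f g : R -> R) (lf lg : R) :
  (forall u, 0 < u -> f u <= g u) ->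
  is_RInt_0_infty f lf -> is_RInt_0_infty g lg -> lf <= lg.
Proof.
  intros H Hf Hg; apply Rminus_le_0.
  apply (RInt_0_infty_ge0 (fun u => g u - f u)).
  - intros u Hu; specialize (H u Hu); lra.
  - now apply (is_RInt_gen_minus (V := R_NormedModule) g f lg lf).
Qed.

(** The integral is the supremum of the proper integrals, which can only grow with the interval when
    the integrand is nonnegative. *)
Lemma RInt_0_infty_nonneg_bounded (f : R -> R) (M : R) :
  (forall u, 0 < u -> continuous f u) -> (forall u, 0 < u -> 0 <= f u) ->
  (forall a b, 0 < a <= b -> RInt f a b <= M) ->
  exists l, is_RInt_0_infty f l /\ forall a b, 0 < a <= b -> RInt f a b <= l.
Proof.
  intros Hc Hp HM.
  assert (Hex : forall a b, 0 < a <= b -> ex_RInt f a b).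
  { intros a b Hab; apply (ex_RInt_continuous (V := R_CompleteNormedModule)).
    intros z; rewrite Rmin_left by lra; intros Hz; apply Hc; lra. }
  set (E := fun v => exists a b, 0 < a <= b /\ v = RInt f a b).
  destruct (completeness E) as [l [Hub Hlub]].
  { exists M; intros v (a & b & Hab & ->); auto. }
  { exists (RInt f 1 1), 1, 1; split; [lra|easy]. }
  assert (Hle : forall a b, 0 < a <= b -> RInt f a b <= l).
  { intros a b Hab; apply Hub; exists a, b; auto. }
  exists l; split; [|exact Hle].
  intros P [eps HP].
  (* Some proper integral comes within [eps] of the supremum; every larger interval then does
     too. *)
  assert (Hnear : exists a0 b0, 0 < a0 <= b0 /\ l - eps < RInt f a0 b0).
  { apply Classical_Prop.NNPP; intros Hn.
    apply (Rlt_not_le l (l - eps)); [assert (H := cond_pos eps); lra|].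
    apply Hlub; intros v (a & b & Hab & ->).
    destruct (Rle_lt_dec (RInt f a b) (l - eps)); auto.
    exfalso; apply Hn; exists a, b; auto. }
  destruct Hnear as (a0 & b0 & Hab0 & Hnear).
  apply filter_imp with (2 := eventually_inside a0 b0 (proj1 Hab0)).
  intros [a b] [Ha Hb]; simpl in *.
  exists (RInt f a b); split.
  - apply (RInt_correct (V := R_CompleteNormedModule)), Hex; lra.
  - apply HP; change (Rabs (RInt f a b - l) < eps).
    assert (H1 : RInt f a b <= l) by (apply Hle; lra).
    assert (H2 : RInt f a0 b0 <= RInt f a b).
    { rewrite <- (RInt_Chasles (V := R_CompleteNormedModule) f a a0 b),
        <- (RInt_Chasles (V := R_CompleteNormedModule) f a0 b0 b)
        by (apply Hex; lra).
      unfold plus; simpl.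
      assert (0 <= RInt f a a0).
      { apply RInt_ge_0; [lra|apply Hex; lra|intros; apply Hp; lra]. }
      assert (0 <= RInt f b0 b).
      { apply RInt_ge_0; [lra|apply Hex; lra|intros; apply Hp; lra]. }
      lra. }
    apply Rabs_def1; lra.
Qed.

(** * Convergence, functional equation and log-convexity of Gamma *)

Definition gamma_integrand (p u : R) : R := Rpower u p * exp (- u).

Lemma gamma_integrand_gt0 (p u : R) : 0 < gamma_integrand p u.
Proof. apply Rmult_lt_0_compat; apply exp_pos. Qed.

Lemma gamma_integrand_derive (p u : R) : 0 < u ->
  is_derive (gamma_integrand p) u
    (p * gamma_integrand (p - 1) u - gamma_integrand p u).
Proof.
  intros Hu; unfold gamma_integrand, Rpower.
  auto_derive; [exact Hu|].
  replace ((p - 1) * ln u) with (p * ln u + - ln u) by ring.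
  rewrite exp_plus, (exp_Ropp (ln u)), exp_ln by exact Hu; field; lra.
Qed.

Lemma gamma_integrand_continuous (p u : R) : 0 < u ->
  continuous (gamma_integrand p) u.
Proof.
  intros Hu; apply (ex_derive_continuous (V := R_NormedModule)).
  eexists; now apply gamma_integrand_derive.
Qed.

Lemma ln_le_minus_1 (y : R) : 0 < y -> ln y <= y - 1.
Proof.
  intros Hy; assert (H := exp_ineq1_le (ln y)); rewrite exp_ln in H; lra.
Qed.

Lemma ln_quotient (x y : R) : 0 < x -> 0 < y -> ln (x / y) = ln x - ln y.
Proof.
  intros Hx Hy; unfold Rdiv; rewrite ln_mult, ln_Rinv; auto with real.
Qed.

(* From [ln (u / (2 p)) <= u / (2 p) - 1]. *)
Lemma gamma_integrand_le (p u : R) : 0 < p -> 0 < u ->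
  gamma_integrand p u <= exp (p * ln (2 * p)) * exp (- u / 2).
Proof.
  intros Hp Hu; unfold gamma_integrand, Rpower; rewrite <- !exp_plus.
  assert (H : ln u <= ln (2 * p) + u / (2 * p)).
  { assert (H := ln_le_minus_1 (u / (2 * p))).
    rewrite ln_quotient in H by lra.
    specialize (H ltac:(apply Rdiv_lt_0_compat; lra)). lra. }
  assert (H' : p * ln u <= p * ln (2 * p) + u / 2).
  { replace (p * ln (2 * p) + u / 2) with (p * (ln (2 * p) + u / (2 * p)))
      by (field; lra).
    apply Rmult_le_compat_l; lra. }
  destruct (Rle_lt_or_eq_dec (p * ln u + - u) (p * ln (2 * p) + - u / 2)) as [h|h];
    [lra|apply Rlt_le, exp_increasing, h|rewrite h; lra].
Qed.

(** The majorant [C * exp (- u / 2)] has the primitive [- 2 * C * exp (- u / 2)], so all proper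
    integrals are at most [2 * C]. Positivity is read off on [[1, 2]]. *)
Lemma gamma_integral (p : R) : 0 < p ->
  is_RInt_0_infty (gamma_integrand p) (Gamma (p + 1)) /\ 0 < Gamma (p + 1).
Proof.
  intros Hp; set (C := exp (p * ln (2 * p))).
  assert (HC : 0 < C) by apply exp_pos.
  assert (Hex : forall a b, 0 < a <= b -> ex_RInt (gamma_integrand p) a b).
  { intros a b Hab; apply (ex_RInt_continuous (V := R_CompleteNormedModule)).
    intros z; rewrite Rmin_left by lra; intros Hz.
    apply gamma_integrand_continuous; lra. }
  destruct (RInt_0_infty_nonneg_bounded (gamma_integrand p) (2 * C)) as [l [Hl Hle]].
  - intros; now apply gamma_integrand_continuous.
  - intros; apply Rlt_le, gamma_integrand_gt0.
  - intros a b Hab.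
    assert (HI : is_RInt (fun u => C * exp (- u / 2)) a b
      (- 2 * C * exp (- b / 2) - - 2 * C * exp (- a / 2))).
    { apply (is_RInt_derive (V := R_CompleteNormedModule)
        (fun u => - 2 * C * exp (- u / 2))).
      - intros; auto_derive; [easy|unfold Rdiv; field].
      - intros; apply (ex_derive_continuous (V := R_NormedModule)); auto_derive; easy. }
    apply Rle_trans with (- 2 * C * exp (- b / 2) - - 2 * C * exp (- a / 2)).
    + rewrite <- (is_RInt_unique _ _ _ _ HI).
      apply RInt_le; [lra|now apply Hex|eexists; exact HI|].
      intros x Hx; apply gamma_integrand_le; lra.
    + assert (exp (- a / 2) <= 1).
      { rewrite <- exp_0; apply Rlt_le, exp_increasing; lra. }
      assert (0 < exp (- b / 2)) by apply exp_pos; nra.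
  - assert (E : Gamma (p + 1) = l).
    { unfold Gamma; apply (is_RInt_gen_unique (V := R_CompleteNormedModule)).
      replace (p + 1 - 1) with p by ring; exact Hl. }
    rewrite E; split; [exact Hl|].
    apply Rlt_le_trans with (2 := Hle 1 2 ltac:(lra)).
    apply RInt_gt_0; [lra| |].
    + intros; apply gamma_integrand_gt0.
    + intros; apply gamma_integrand_continuous; lra.
Qed.

Lemma gamma_integrand_vanishes_0 (p : R) : 1 <= p ->
  filterlim (gamma_integrand p) (at_right 0) (locally 0).
Proof.
  intros Hp P [eps HP].
  assert (Hm : 0 < Rmin eps 1) by (apply Rmin_pos; [apply cond_pos|lra]).
  exists (mkposreal _ Hm); intros u Hu Hpos; apply HP.
  change (Rabs (minus u 0) < Rmin eps 1) in Hu.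
  unfold minus, plus, opp in Hu; simpl in Hu.
  rewrite Ropp_0, Rplus_0_r in Hu; apply Rabs_def2 in Hu.
  assert (h1 := Rmin_l eps 1); assert (h2 := Rmin_r eps 1).
  change (Rabs (gamma_integrand p u - 0) < eps).
  assert (H0 := gamma_integrand_gt0 p u).
  rewrite Rminus_0_r, Rabs_pos_eq by lra.
  (* For [0 < u < 1] and [p >= 1] one has [p * ln u - u <= ln u]. *)
  apply Rle_lt_trans with u; [|lra].
  rewrite <- (exp_ln u) at 2 by exact Hpos.
  unfold gamma_integrand, Rpower; rewrite <- exp_plus.
  assert (Hln : ln u < 0) by (rewrite <- ln_1; apply ln_increasing; lra).
  apply Rlt_le, exp_increasing; nra.
Qed.

Lemma gamma_integrand_vanishes_infty (p : R) : 0 < p ->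
  filterlim (gamma_integrand p) (Rbar_locally p_infty) (locally 0).
Proof.
  intros Hp; set (C := exp (p * ln (2 * p))).
  assert (HC : 0 < C) by apply exp_pos.
  intros P [eps HP].
  (* Beyond [2 * C / eps], the bound [exp (u / 2) >= 1 + u / 2] pushes the majorant
     [C / exp (u / 2)] below [eps]. *)
  exists (Rmax 0 (2 * C / eps)); intros u Hu; apply HP.
  assert (He := cond_pos eps).
  assert (h1 := Rmax_l 0 (2 * C / eps)); assert (h2 := Rmax_r 0 (2 * C / eps)).
  change (Rabs (gamma_integrand p u - 0) < eps).
  assert (H0 := gamma_integrand_gt0 p u).
  rewrite Rminus_0_r, Rabs_pos_eq by lra.
  apply Rle_lt_trans with (1 := gamma_integrand_le p u Hp ltac:(lra)).
  fold C; replace (- u / 2) with (- (u / 2)) by field; rewrite exp_Ropp.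
  assert (H := exp_ineq1_le (u / 2)).
  apply Rlt_div_l; [apply exp_pos|].
  assert (2 * C < u * eps) by (apply Rlt_div_l; [exact He|lra]).
  nra.
Qed.

(** Integration by parts: the integrand is the derivative of [gamma_integrand p], which vanishes at
    both ends. *)
Lemma gamma_integrand_derivative_integral (p : R) : 1 <= p ->
  is_RInt_0_infty (fun u => p * gamma_integrand (p - 1) u - gamma_integrand p u) 0.
Proof.
  intros Hp.
  apply (RInt_0_infty_ext (Derive (gamma_integrand p))).
  { intros u Hu; now apply is_derive_unique, gamma_integrand_derive. }
  enough (H : is_RInt_0_infty (Derive (gamma_integrand p)) (0 - 0))
    by (rewrite Rminus_0_r in H; exact H).
  apply (is_RInt_gen_Derive (gamma_integrand p) 0 0).
  - apply filter_imp with (2 := eventually_inside 1 1 Rlt_0_1).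
    intros [a b] Hab x; simpl in *; rewrite Rmin_left by lra; intros Hx.
    eexists; apply gamma_integrand_derive; lra.
  - apply filter_imp with (2 := eventually_inside 1 1 Rlt_0_1).
    intros [a b] Hab x; simpl in *; rewrite Rmin_left by lra; intros Hx.
    apply continuous_ext_loc with
      (fun u => p * gamma_integrand (p - 1) u - gamma_integrand p u).
    + apply (locally_interval _ x 0 p_infty); simpl; [lra|easy|].
      intros y Hy _; symmetry; now apply is_derive_unique, gamma_integrand_derive.
    + apply (ex_derive_continuous (V := R_NormedModule)).
      unfold gamma_integrand, Rpower; auto_derive; lra.
  - now apply gamma_integrand_vanishes_0.
  - apply gamma_integrand_vanishes_infty; lra.
Qed.

Lemma Gamma_succ (p : R) : 0 < p -> Gamma (p + 2) = (p + 1) * Gamma (p + 1).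
Proof.
  intros Hp.
  assert (H := gamma_integrand_derivative_integral (p + 1) ltac:(lra)).
  assert (H1 := proj1 (gamma_integral p Hp)).
  assert (H2 := proj1 (gamma_integral (p + 1) ltac:(lra))).
  replace (p + 1 + 1) with (p + 2) in H2 by ring.
  replace (p + 1 - 1) with p in H by ring.
  assert (H3 := RInt_0_infty_lincomb _ _ (p + 1) (-1) _ _ H1 H2).
  apply (RInt_0_infty_ext _
    (fun u => (p + 1) * gamma_integrand p u - gamma_integrand (p + 1) u)) in H3;
    [|intros u _; ring].
  assert (E := RInt_0_infty_unique _ _ _ H H3); lra.
Qed.

(** The starting value, which [Gamma_succ] does not reach since it assumes [0 < p]. It comes from
    the primitive [- (u + 1) * exp (- u)] of [u * exp (- u)]. *)
Lemma Gamma_2 : Gamma (1 + 1) = 1.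
Proof.
  unfold Gamma; apply (is_RInt_gen_unique (V := R_CompleteNormedModule)).
  apply (RInt_0_infty_ext (Derive (fun u => - (u + 1) * exp (- u)))).
  { intros u Hu; apply is_derive_unique.
    replace (1 + 1 - 1) with 1 by ring; rewrite Rpower_1 by exact Hu.
    auto_derive; [easy|ring]. }
  assert (Hc : forall x, continuous (Derive (fun u => - (u + 1) * exp (- u))) x).
  { intros x; apply continuous_ext with (fun u => u * exp (- u)).
    - intros u; symmetry; apply is_derive_unique; auto_derive; [easy|ring].
    - apply (ex_derive_continuous (V := R_NormedModule)); auto_derive; easy. }
  assert (E : 0 - - (0 + 1) * exp (- 0) = 1) by (rewrite Ropp_0, exp_0; ring).
  enough (H : is_RInt_0_infty (Derive (fun u => - (u + 1) * exp (- u)))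
    (0 - - (0 + 1) * exp (- 0))) by (rewrite E in H; exact H); clear E.
  apply (is_RInt_gen_Derive (fun u => - (u + 1) * exp (- u)) (- (0 + 1) * exp (- 0)) 0).
  - apply filter_forall; intros; auto_derive; easy.
  - apply filter_forall; intros; apply Hc.
  - eapply filterlim_filter_le_1.
    + apply filter_le_within.
    + apply (ex_derive_continuous (V := R_NormedModule) (fun u => - (u + 1) * exp (- u))).
      auto_derive; easy.
  - assert (H1 := gamma_integrand_vanishes_infty 1 Rlt_0_1).
    assert (He : is_lim (fun u => exp (- u)) p_infty 0).
    { apply (is_lim_comp exp (fun u => - u) p_infty 0 m_infty).
      - apply is_lim_exp_m.
      - apply (is_lim_opp (fun u => u) p_infty p_infty), is_lim_id.
      - now exists 0. }
    assert (Hs : is_lim (fun u => - (gamma_integrand 1 u + exp (- u))) p_infty 0).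
    { replace (Finite 0) with (Rbar_opp (0 + 0)) by (simpl; f_equal; ring).
      apply is_lim_opp, is_lim_plus'; assumption. }
    change (is_lim (fun u => - (u + 1) * exp (- u)) p_infty 0).
    apply (is_lim_ext_loc (fun u => - (gamma_integrand 1 u + exp (- u)))); auto.
    exists 0; intros u Hu; unfold gamma_integrand.
    rewrite Rpower_1 by exact Hu; ring.
Qed.

(** The tangent at the mean [Z] lies below [exp]; its weighted values at [X] and [Y] add up to
    [exp Z]. *)
Lemma exp_convex (s X Y : R) : 0 <= s <= 1 ->
  exp ((1 - s) * X + s * Y) <= (1 - s) * exp X + s * exp Y.
Proof.
  intros Hs; set (Z := (1 - s) * X + s * Y).
  assert (H : forall T, exp Z * (1 + (T - Z)) <= exp T).
  { intros T; replace T with (Z + (T - Z)) at 2 by ring; rewrite exp_plus.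
    apply Rmult_le_compat_l; [apply Rlt_le, exp_pos|apply exp_ineq1_le]. }
  assert (HX := Rmult_le_compat_l (1 - s) _ _ ltac:(lra) (H X)).
  assert (HY := Rmult_le_compat_l s _ _ ltac:(lra) (H Y)).
  assert (E : (1 - s) * (exp Z * (1 + (X - Z))) + s * (exp Z * (1 + (Y - Z))) = exp Z)
    by (unfold Z; ring).
  lra.
Qed.

(* Weighted AM-GM under the integral sign, after normalising both integrands. *)
Lemma ln_Gamma_convex (s p q : R) : 0 <= s <= 1 -> 0 < p -> 0 < q ->
  ln (Gamma ((1 - s) * p + s * q + 1)) <=
  (1 - s) * ln (Gamma (p + 1)) + s * ln (Gamma (q + 1)).
Proof.
  intros Hs Hp Hq; set (r := (1 - s) * p + s * q).
  assert (Hr : 0 < r) by (unfold r; nra).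
  destruct (gamma_integral p Hp) as [Ip Gp].
  destruct (gamma_integral q Hq) as [Iq Gq].
  destruct (gamma_integral r Hr) as [Ir Gr].
  set (A := Gamma (p + 1)) in *; set (B := Gamma (q + 1)) in *.
  (* [exp c] is the weighted geometric mean of [A] and [B]. *)
  set (c := (1 - s) * ln A + s * ln B).
  assert (H : Gamma (r + 1) <= exp c * ((1 - s) / A) * A + exp c * (s / B) * B).
  { apply (RInt_0_infty_le (gamma_integrand r) (fun u =>
      exp c * ((1 - s) / A) * gamma_integrand p u +
      exp c * (s / B) * gamma_integrand q u)); [|exact Ir|].
    - intros u Hu; unfold gamma_integrand, Rpower.
      assert (HA : forall x, exp (x - ln A) = exp x / A).
      { intros x; unfold Rminus; rewrite exp_plus, exp_Ropp, exp_ln; auto. }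
      assert (HB : forall x, exp (x - ln B) = exp x / B).
      { intros x; unfold Rminus; rewrite exp_plus, exp_Ropp, exp_ln; auto. }
      assert (H := exp_convex s (p * ln u + - u - ln A) (q * ln u + - u - ln B) Hs).
      rewrite HA, HB in H.
      set (m := (1 - s) * (p * ln u + - u - ln A) + s * (q * ln u + - u - ln B)) in H.
      rewrite <- !exp_plus.
      replace (r * ln u + - u) with (c + m) by (unfold c, m, r; ring).
      rewrite (exp_plus c).
      set (X := exp (p * ln u + - u)) in *; set (Y := exp (q * ln u + - u)) in *.
      replace (exp c * ((1 - s) / A) * X + exp c * (s / B) * Y) with
        (exp c * ((1 - s) * (X / A) + s * (Y / B))) by (field; lra).
      apply Rmult_le_compat_l; [apply Rlt_le, exp_pos|exact H].
    - now apply RInt_0_infty_lincomb. }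
  replace (exp c * ((1 - s) / A) * A + exp c * (s / B) * B) with (exp c) in H
    by (field; lra).
  rewrite <- (ln_exp c).
  destruct H as [H|H]; [apply Rlt_le, ln_increasing; auto|rewrite H; lra].
Qed.

(** * Stirling's formula *)

(** Logarithm of Stirling's approximation [sqrt (2 PI x) (x / e)^x]; the difference from
    [ln (Gamma (x + 1))], defined next, is the function called [phi] above. *)
Definition stirling_exponent (x : R) : R :=
  / 2 * ln (2 * PI) + / 2 * ln x + x * ln x - x.

Definition stirling_error (x : R) : R := ln (Gamma (x + 1)) - stirling_exponent x.

Definition error_step (x : R) : R := (x + / 2) * (ln (x + 1) - ln x) - 1.

Lemma ln_Gamma_succ (x : R) : 0 < x ->
  ln (Gamma (x + 1 + 1)) = ln (x + 1) + ln (Gamma (x + 1)).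
Proof.
  intros Hx; replace (x + 1 + 1) with (x + 2) by ring.
  rewrite Gamma_succ by exact Hx; apply ln_mult; [lra|now apply gamma_integral].
Qed.

Lemma stirling_error_step (x : R) : 0 < x ->
  stirling_error x - stirling_error (x + 1) = error_step x.
Proof.
  intros Hx; unfold stirling_error, stirling_exponent, error_step.
  rewrite ln_Gamma_succ by exact Hx; field.
Qed.

Lemma ln_diff_le (x y : R) : 0 < x -> 0 < y -> ln y - ln x <= (y - x) / x.
Proof.
  intros Hx Hy; rewrite <- ln_quotient by assumption.
  apply Rle_trans with (1 := ln_le_minus_1 (y / x) ltac:(apply Rdiv_lt_0_compat; lra)).
  apply Req_le; field; lra.
Qed.

Lemma ln_diff_ge (x y : R) : 0 < x -> 0 < y -> (y - x) / y <= ln y - ln x.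
Proof.
  intros Hx Hy; assert (H := ln_diff_le y x Hy Hx).
  replace ((y - x) / y) with (- ((x - y) / y)) by (field; lra); lra.
Qed.

Lemma inv_shift_lim (x : R) : is_lim_seq (fun n => / (x + INR n)) 0.
Proof.
  replace (Finite 0) with (Rbar_inv p_infty) by easy.
  apply is_lim_seq_inv; [|easy].
  apply is_lim_seq_plus with x p_infty; [apply is_lim_seq_const|apply is_lim_seq_INR|easy].
Qed.

Lemma vanishing_of_inv_bound (c x : R) (u : nat -> R) :
  (forall n, Rabs (u n) <= c * / (x + INR n)) -> is_lim_seq u 0.
Proof.
  intros H; apply is_lim_seq_abs_0.
  apply is_lim_seq_le_le with (fun _ => 0) (fun n => c * / (x + INR n)).
  - intros n; split; [apply Rabs_pos|apply H].
  - apply is_lim_seq_const.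
  - replace (Finite 0) with (Rbar_mult c 0) by (simpl; f_equal; ring).
    apply is_lim_seq_scal_l, inv_shift_lim.
Qed.

(** Multiplying [1 / (y + 1) <= ln (y + 1) - ln y <= 1 / y] by [y + 1/2] puts [error_step y] between
    [- 1 / (2 (y + 1))] and [1 / (2 y)]. *)
Lemma error_step_vanishes (x : R) : 1 <= x ->
  is_lim_seq (fun n => error_step (x + INR n)) 0.
Proof.
  intros Hx; apply vanishing_of_inv_bound with 1 x; intros n.
  assert (Hn := pos_INR n); set (y := x + INR n); assert (Hy : 1 <= y) by (unfold y; lra).
  assert (H1 := ln_diff_le y (y + 1) ltac:(lra) ltac:(lra)).
  assert (H2 := ln_diff_ge y (y + 1) ltac:(lra) ltac:(lra)).
  replace ((y + 1 - y) / y) with (/ y) in H1 by (field; lra).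
  replace ((y + 1 - y) / (y + 1)) with (/ (y + 1)) in H2 by (field; lra).
  apply (Rmult_le_compat_l (y + / 2)) in H1; [|lra].
  apply (Rmult_le_compat_l (y + / 2)) in H2; [|lra].
  replace ((y + / 2) * / y) with (1 + / 2 * / y) in H1 by (field; lra).
  replace ((y + / 2) * / (y + 1)) with (1 - / 2 * / (y + 1)) in H2 by (field; lra).
  assert (/ (y + 1) <= / y) by (apply Rinv_le_contravar; lra).
  assert (0 < / y) by (apply Rinv_0_lt_compat; lra).
  assert (0 < / (y + 1)) by (apply Rinv_0_lt_compat; lra).
  unfold error_step; apply Rabs_le; lra.
Qed.

Lemma error_step_D2 :
  has_D2 error_step (fun x => / (2 * x ^ 2 * (x + 1) ^ 2)).
Proof.
  exists (fun x => ln (x + 1) - ln x + (x + / 2) * (/ (x + 1) - / x)).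
  intros x Hx; unfold error_step; split.
  - auto_derive; [lra|field; lra].
  - auto_derive; [repeat split; lra|field; lra].
Qed.

Lemma inv_D2 (c : R) : has_D2 (fun x => c / x) (fun x => 2 * c / x ^ 3).
Proof.
  exists (fun x => - c / x ^ 2); intros x Hx; split.
  - auto_derive; [lra|field; lra].
  - auto_derive; [intros H; revert H; apply Rgt_not_eq, Rmult_lt_0_compat; lra|field; lra].
Qed.

Lemma error_step_gt0 (x : R) : 1 <= x -> 0 < error_step x.
Proof.
  intros Hx; apply vanishing_D2_gt0 with (2 := error_step_D2); auto.
  - intros y Hy; apply Rinv_0_lt_compat; apply Rmult_lt_0_compat; [|apply pow_lt; lra].
    apply Rmult_lt_0_compat; [lra|apply pow_lt; lra].
  - now apply error_step_vanishes.
Qed.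

(** For positive [x] this is the increment from [x + 1] back to [x] of
    [1 / (12 x) - stirling_error x]. *)
Definition step_gap (x : R) : R := / 12 / x - / 12 / (x + 1) - error_step x.

Lemma step_gap_D2 : has_D2 step_gap (fun x => / (6 * (x * (x + 1)) ^ 3)).
Proof.
  apply has_D2_ext with (3 := has_D2_minus _ _ _ _
    (has_D2_minus _ _ _ _ (inv_D2 (/ 12)) (has_D2_shift _ _ (inv_D2 (/ 12))))
    error_step_D2).
  - intros x Hx; field; lra.
  - easy.
Qed.

Lemma step_gap_D2_gt0 (x : R) : 1 <= x -> 0 < / (6 * (x * (x + 1)) ^ 3).
Proof.
  intros Hx; apply Rinv_0_lt_compat, Rmult_lt_0_compat; [lra|].
  apply pow_lt, Rmult_lt_0_compat; lra.
Qed.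

Lemma inv_vanishes (c x : R) : is_lim_seq (fun n => c / (x + INR n)) 0.
Proof.
  replace (Finite 0) with (Rbar_mult c 0) by (simpl; f_equal; ring).
  apply is_lim_seq_scal_l, inv_shift_lim.
Qed.

Lemma step_gap_gt0 (x : R) : 1 <= x -> 0 < step_gap x.
Proof.
  intros Hx; apply vanishing_D2_gt0 with (2 := step_gap_D2); auto.
  - apply step_gap_D2_gt0.
  - unfold step_gap; replace (Finite 0) with (Finite (0 - 0 - 0)) by (f_equal; ring).
    apply is_lim_seq_minus'; [apply is_lim_seq_minus'|now apply error_step_vanishes].
    + apply inv_vanishes.
    + apply is_lim_seq_ext with (2 := inv_vanishes (/ 12) (x + 1)).
      intros n; f_equal; ring.
Qed.

(** Along the integers [stirling_error] decreases, as [error_step] is positive, while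
    [stirling_error x - 1 / (12 x)] increases, as [step_gap] is positive; the value of the latter at
    1 is a lower bound. *)
Lemma stirling_error_converges :
  exists c, is_lim_seq (fun n => stirling_error (1 + INR n)) (Finite c).
Proof.
  apply ex_finite_lim_seq_decr with (stirling_error 1 - / 12 / 1).
  - intros n; rewrite S_INR; assert (Hn := pos_INR n).
    assert (H := stirling_error_step (1 + INR n) ltac:(lra)).
    assert (H' := error_step_gt0 (1 + INR n) ltac:(lra)).
    rewrite <- Rplus_assoc; lra.
  - intros n; apply Rle_trans with (stirling_error (1 + INR n) - / 12 / (1 + INR n)).
    + induction n as [|n IH]; [simpl; rewrite Rplus_0_r; lra|].
      apply Rle_trans with (1 := IH); rewrite S_INR, <- Rplus_assoc.
      assert (Hn := pos_INR n).
      assert (H := stirling_error_step (1 + INR n) ltac:(lra)).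
      assert (H' := step_gap_gt0 (1 + INR n) ltac:(lra)).
      unfold step_gap in H'; lra.
    + assert (Hn := pos_INR n).
      assert (0 < / (1 + INR n)) by (apply Rinv_0_lt_compat; lra).
      unfold Rdiv; lra.
Qed.

(** * Wallis integrals and the limit of the error *)

Definition wallis (n : nat) : R := RInt (fun x => sin x ^ n) 0 (PI / 2).

Lemma sin_pow_continuous (n : nat) (x : R) : continuous (fun x => sin x ^ n) x.
Proof. apply (ex_derive_continuous (V := R_NormedModule)); auto_derive; easy. Qed.

Lemma wallis_ex (n : nat) : ex_RInt (fun x => sin x ^ n) 0 (PI / 2).
Proof.
  apply (ex_RInt_continuous (V := R_CompleteNormedModule)).
  intros; apply sin_pow_continuous.
Qed.

Lemma wallis_0 : wallis 0 = PI / 2.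
Proof.
  unfold wallis; simpl; rewrite RInt_const; unfold scal; simpl; unfold mult; simpl; lra.
Qed.

Lemma wallis_1 : wallis 1 = 1.
Proof.
  unfold wallis; apply (is_RInt_unique (V := R_CompleteNormedModule)).
  assert (E : - cos (PI / 2) - - cos 0 = 1) by (rewrite cos_PI2, cos_0; ring).
  rewrite <- E; clear E.
  apply (is_RInt_derive (V := R_CompleteNormedModule) (fun x => - cos x)).
  - intros x _; auto_derive; [easy|ring].
  - intros; apply sin_pow_continuous.
Qed.

(** The difference of the two integrands is the derivative of [- cos x * sin x ^ (n + 1)], which is
    0 at both end points. *)
Lemma wallis_rec (n : nat) :
  (INR n + 2) * wallis (S (S n)) = (INR n + 1) * wallis n.
Proof.
  assert (H : is_RInt (fun x => (INR n + 2) * sin x ^ S (S n) - (INR n + 1) * sin x ^ n)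
    0 (PI / 2) (- cos (PI / 2) * sin (PI / 2) ^ S n - - cos 0 * sin 0 ^ S n)).
  { apply (is_RInt_derive (V := R_CompleteNormedModule) (fun x => - cos x * sin x ^ S n)).
    - intros x _; auto_derive; [easy|].
      rewrite <- !tech_pow_Rmult.
      (* The derivative of the power produces [INR (S n)] in this unfolded form. *)
      replace (match n with 0%nat => 1 | S _ => INR n + 1 end) with (INR (S n)) by easy.
      rewrite S_INR.
      assert (E : cos x * cos x = 1 - sin x * sin x).
      { assert (E := sin2_cos2 x); unfold Rsqr in E; lra. }
      simpl Init.Nat.pred.
      transitivity (sin x * sin x * sin x ^ n - (INR n + 1) * (cos x * cos x) * sin x ^ n).
      + ring.
      + rewrite E; ring.
    - intros x _; apply (ex_derive_continuous (V := R_NormedModule)); auto_derive; easy. }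
  assert (H' := is_RInt_minus (V := R_NormedModule) _ _ _ _ _ _
    (is_RInt_scal (V := R_NormedModule) _ _ _ (INR n + 2) _
      (RInt_correct (V := R_CompleteNormedModule) _ _ _ (wallis_ex (S (S n)))))
    (is_RInt_scal (V := R_NormedModule) _ _ _ (INR n + 1) _
      (RInt_correct (V := R_CompleteNormedModule) _ _ _ (wallis_ex n)))).
  assert (E := is_RInt_unique (V := R_CompleteNormedModule) _ _ _ _ H').
  assert (E' := is_RInt_unique (V := R_CompleteNormedModule) _ _ _ _ H).
  change (RInt (fun x => (INR n + 2) * sin x ^ S (S n) - (INR n + 1) * sin x ^ n)
    0 (PI / 2) = (INR n + 2) * wallis (S (S n)) - (INR n + 1) * wallis n) in E.
  rewrite E' in E; rewrite cos_PI2, sin_0, pow_i in E by lia; lra.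
Qed.

Lemma wallis_decr (n : nat) : wallis (S n) <= wallis n.
Proof.
  assert (HPI := PI_RGT_0).
  apply RInt_le; [lra|apply wallis_ex|apply wallis_ex|].
  intros x Hx; rewrite <- tech_pow_Rmult.
  assert (0 <= sin x) by (apply sin_ge_0; lra).
  assert (sin x <= 1) by apply SIN_bound.
  assert (0 <= sin x ^ n) by (apply pow_le; lra); nra.
Qed.

(** By the recurrence the left side does not depend on [n]. *)
Lemma wallis_product (n : nat) : (INR n + 1) * (wallis (S n) * wallis n) = PI / 2.
Proof.
  induction n as [|n IH].
  - rewrite wallis_0, wallis_1; simpl; ring.
  - rewrite <- IH, S_INR; assert (H := wallis_rec n).
    replace ((INR n + 1 + 1) * (wallis (S (S n)) * wallis (S n)))
      with ((INR n + 2) * wallis (S (S n)) * wallis (S n)) by ring.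
    rewrite H; ring.
Qed.

Lemma wallis_gt0 (n : nat) : 0 < wallis n.
Proof.
  assert (HPI := PI_RGT_0).
  apply RInt_gt_0; [lra| |].
  - intros x Hx; apply pow_lt, sin_gt_0; lra.
  - intros; apply sin_pow_continuous.
Qed.

(** With [m = n + 1], this is the logarithm of [(PI / 2) (2 m)! / (4^m m!^2)]. Starting at [m = 1]
    keeps the arguments of Gamma at 2 or more. *)
Lemma ln_wallis_even (n : nat) :
  ln (wallis (2 * S n)) = ln (PI / 2) + ln (Gamma (2 * (1 + INR n) + 1))
    - 2 * (1 + INR n) * ln 2 - 2 * ln (Gamma (1 + INR n + 1)).
Proof.
  assert (HPI := PI_RGT_0).
  assert (Hrec : forall n, ln (wallis (2 * S n)) =
    ln (wallis (2 * n)) + ln (2 * INR n + 1) - ln 2 - ln (INR n + 1)).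
  { intros k; assert (H := wallis_rec (2 * k)); assert (Hk := pos_INR k).
    replace (2 * S k)%nat with (S (S (2 * k))) by lia.
    rewrite mult_INR in H; change (INR 2) with 2 in H.
    assert (E : wallis (S (S (2 * k))) =
      wallis (2 * k) * ((2 * INR k + 1) / (2 * (INR k + 1)))).
    { apply Rmult_eq_reg_l with (2 * INR k + 2); [rewrite H; field|]; lra. }
    rewrite E, ln_mult, ln_quotient, ln_mult; try lra.
    - apply wallis_gt0.
    - apply Rdiv_lt_0_compat; lra. }
  induction n as [|n IH].
  - rewrite Hrec; simpl; rewrite wallis_0, Rplus_0_r, Gamma_2,
      Rmult_1_r, Rmult_0_r, !Rplus_0_l, ln_1.
    replace (2 + 1) with (1 + 2) by ring.
    rewrite Gamma_succ by lra; rewrite Gamma_2, Rmult_1_r.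
    replace (1 + 1) with 2 by ring; ring.
  - rewrite Hrec, IH, S_INR; assert (Hn := pos_INR n).
    set (x := 1 + INR n); assert (Hx : 1 <= x) by (unfold x; lra).
    replace (1 + (INR n + 1)) with (x + 1) by (unfold x; ring).
    replace (INR n + 1) with x by (unfold x; ring).
    replace (2 * (x + 1) + 1) with ((2 * x + 1) + 1 + 1) by ring.
    rewrite !ln_Gamma_succ by lra.
    replace (2 * x + 1 + 1) with (2 * (x + 1)) by ring.
    rewrite ln_mult by lra; ring.
Qed.

(** Monotonicity and [wallis_product] give [2 m w^2 <= PI / 2 <= (2 m + 1) w^2] for [m = n + 1] and
    [w = wallis (2 m)]; then take logarithms. *)
Lemma wallis_even_bounds (n : nat) :
  - / (1 + INR n) <= 2 * ln (wallis (2 * S n)) + ln (2 * (1 + INR n)) - ln (PI / 2) <= 0.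
Proof.
  assert (HPI := PI_RGT_0); assert (Hn := pos_INR n).
  set (x := 1 + INR n); assert (Hx : 1 <= x) by (unfold x; lra).
  set (w := wallis (2 * S n)); assert (Hw : 0 < w) by apply wallis_gt0.
  assert (E : INR (2 * S n) = 2 * x).
  { rewrite mult_INR, (S_INR n); change (INR 2) with 2; unfold x; ring. }
  assert (H1 := wallis_product (2 * S n)); rewrite E in H1; fold w in H1.
  assert (H2 := wallis_product (S (2 * n))).
  replace (S (S (2 * n))) with (2 * S n)%nat in H2 by lia.
  replace (INR (S (2 * n)) + 1) with (2 * x) in H2
    by (rewrite <- E, <- S_INR; f_equal; lia).
  fold w in H2.
  assert (D1 := wallis_decr (2 * S n)); fold w in D1.
  assert (D2 := wallis_decr (S (2 * n))).
  replace (S (S (2 * n))) with (2 * S n)%nat in D2 by lia; fold w in D2.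
  assert (L : forall y, 0 < y -> 2 * ln w + ln y = ln (y * (w * w))).
  { intros y Hy; rewrite !ln_mult; try lra; now apply Rmult_lt_0_compat. }
  split.
  - assert (U1 : PI / 2 <= (2 * x + 1) * (w * w)).
    { rewrite <- H1; apply Rmult_le_compat_l; [lra|]; nra. }
    apply ln_le in U1; [|lra].
    rewrite <- L in U1 by lra.
    assert (H3 := ln_diff_le (2 * x) (2 * x + 1) ltac:(lra) ltac:(lra)).
    replace ((2 * x + 1 - 2 * x) / (2 * x)) with (/ 2 * / x) in H3 by (field; lra).
    assert (0 < / x) by (apply Rinv_0_lt_compat; lra); lra.
  - rewrite L by lra.
    assert (U2 : 2 * x * (w * w) <= PI / 2).
    { rewrite <- H2; apply Rmult_le_compat_l; [lra|]; nra. }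
    apply ln_le in U2; [lra|].
    apply Rmult_lt_0_compat; [lra|nra].
Qed.

(** The factor [sqrt (2 PI)] is fixed here: it is what leaves no constant on the right. *)
Lemma stirling_error_wallis (n : nat) :
  2 * ln (wallis (2 * S n)) + ln (2 * (1 + INR n)) - ln (PI / 2) =
  2 * stirling_error (2 * (1 + INR n)) - 4 * stirling_error (1 + INR n).
Proof.
  assert (HPI := PI_RGT_0); assert (Hn := pos_INR n).
  rewrite ln_wallis_even; unfold stirling_error, stirling_exponent.
  rewrite !ln_mult, ln_quotient by lra; field.
Qed.

(** If [c] is the limit, the combination of [stirling_error_wallis] tends to [2 c - 4 c], and to 0
    by the Wallis bounds. *)
Lemma stirling_error_nat_vanishes :
  is_lim_seq (fun n => stirling_error (1 + INR n)) 0.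
Proof.
  destruct stirling_error_converges as [c Hc].
  enough (c = 0) by (subst; exact Hc).
  assert (H : is_lim_seq (fun n =>
    2 * stirling_error (2 * (1 + INR n)) - 4 * stirling_error (1 + INR n))
    (Finite (2 * c - 4 * c))).
  { apply is_lim_seq_minus'.
    - apply (is_lim_seq_scal_l _ 2 c).
      (* [2 (1 + n) = 1 + (2 n + 1)]: a subsequence of the integer values. *)
      apply is_lim_seq_ext with (fun n => stirling_error (1 + INR (2 * n + 1))).
      + intros n; rewrite plus_INR, mult_INR; f_equal; simpl; ring.
      + apply (is_lim_seq_subseq (fun n => stirling_error (1 + INR n)) c
          (fun n => (2 * n + 1)%nat)); [|exact Hc].
        apply eventually_subseq; intros; lia.
    - now apply (is_lim_seq_scal_l _ 4 c). }
  assert (H0 : is_lim_seq (fun n =>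
    2 * stirling_error (2 * (1 + INR n)) - 4 * stirling_error (1 + INR n)) 0).
  { apply vanishing_of_inv_bound with 1 1; intros n; rewrite <- stirling_error_wallis.
    assert (Hb := wallis_even_bounds n); assert (Hn := pos_INR n).
    assert (0 < / (1 + INR n)) by (apply Rinv_0_lt_compat; lra).
    apply Rabs_le; lra. }
  apply is_lim_seq_unique in H; apply is_lim_seq_unique in H0.
  rewrite H in H0; injection H0; lra.
Qed.

(* Convexity of [ln Gamma] on [k, k + 1] and on [k + s, k + s + 1]. *)
Lemma stirling_error_near (k s : R) : 1 <= k -> 0 <= s <= 1 ->
  Rabs (stirling_error (k + s) - stirling_error k) <= 2 * / k.
Proof.
  intros Hk Hs.
  (* [U] bounds [ln (Gamma (k + s + 1))] above. [V] writes [k + 1] as a mean of [k + s] and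
     [k + s + 1] and so bounds it below. *)
  assert (U := ln_Gamma_convex s k (k + 1) Hs ltac:(lra) ltac:(lra)).
  assert (V := ln_Gamma_convex (1 - s) (k + s) (k + s + 1)
    ltac:(lra) ltac:(lra) ltac:(lra)).
  replace ((1 - s) * k + s * (k + 1)) with (k + s) in U by ring.
  replace ((1 - (1 - s)) * (k + s) + (1 - s) * (k + s + 1)) with (k + 1) in V by ring.
  rewrite ln_Gamma_succ in U, V by lra.
  rewrite ln_Gamma_succ in V by lra.
  assert (A1 := ln_diff_le k (k + s) ltac:(lra) ltac:(lra)).
  assert (A2 := ln_diff_ge k (k + s) ltac:(lra) ltac:(lra)).
  assert (B1 := ln_diff_le (k + s) (k + 1) ltac:(lra) ltac:(lra)).
  assert (B2 := ln_le (k + s) (k + 1) ltac:(lra) ltac:(lra)).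
  assert (C1 := ln_diff_le (k + 1) (k + s + 1) ltac:(lra) ltac:(lra)).
  assert (C2 := ln_le (k + 1) (k + s + 1) ltac:(lra) ltac:(lra)).
  assert (Ik : 0 < / k) by (apply Rinv_0_lt_compat; lra).
  set (A := ln (k + s) - ln k) in *.
  set (B := ln (k + 1) - ln (k + s)) in *.
  set (C := ln (k + s + 1) - ln (k + 1)) in *.
  assert (HA1 : (k + / 2) * A <= s + / 2 * / k).
  { apply Rle_trans with ((k + / 2) * ((k + s - k) / k)).
    - apply Rmult_le_compat_l; lra.
    - replace ((k + / 2) * ((k + s - k) / k)) with (s + s * (/ 2 * / k)) by (field; lra).
      nra. }
  assert (HA2 : s - / k <= (k + / 2) * A).
  { apply Rle_trans with (k * ((k + s - k) / (k + s))).
    - replace (k * ((k + s - k) / (k + s))) with (s - s * s * / (k + s)) by (field; lra).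
      assert (/ (k + s) <= / k) by (apply Rinv_le_contravar; lra).
      assert (0 < / (k + s)) by (apply Rinv_0_lt_compat; lra).
      assert (0 <= s * s <= 1) by nra; nra.
    - assert (0 <= A) by (apply Rle_trans with (2 := A2), Rdiv_le_0_compat; lra).
      apply Rle_trans with (k * A); [apply Rmult_le_compat_l; lra|nra]. }
  assert (HB : 0 <= s * B <= / k).
  { assert (B <= / k).
    { apply Rle_trans with (1 := B1), Rle_trans with (/ (k + s)).
      - apply Rle_trans with (1 / (k + s)); [|lra].
        apply Rmult_le_compat_r; [apply Rlt_le, Rinv_0_lt_compat|]; lra.
      - apply Rinv_le_contravar; lra. }
    assert (0 <= B) by (unfold B; lra); nra. }
  assert (HC : 0 <= (1 - s) * C <= / k).
  { assert (C <= / k).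
    { apply Rle_trans with (1 := C1), Rle_trans with (/ (k + 1)).
      - apply Rle_trans with (1 / (k + 1)); [|lra].
        apply Rmult_le_compat_r; [apply Rlt_le, Rinv_0_lt_compat|]; lra.
      - apply Rinv_le_contravar; lra. }
    assert (0 <= C) by (unfold C; lra); nra. }
  unfold stirling_error, stirling_exponent.
  (* The two bounds, freed of [ln Gamma] and of the linear term [s] of the exponent. [(k + / 2) * A]
     is [s] up to [1 / k], the other terms are at most [1 / k]. *)
  assert (Elo : ln (k + 1) - (1 - s) * ln (k + s + 1)
    - (/ 2 * ln (k + s) + (k + s) * ln (k + s) - / 2 * ln k - k * ln k) =
    s * B - (1 - s) * C - (k + / 2) * A) by (unfold A, B, C; ring).
  assert (Ehi : s * ln (k + 1)
    - (/ 2 * ln (k + s) + (k + s) * ln (k + s) - / 2 * ln k - k * ln k) =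
    s * B - (k + / 2) * A) by (unfold A, B; ring).
  apply Rabs_le; lra.
Qed.

(** Write [x = 1 + m + s] with [m] a natural number and [0 <= s < 1], and compare with the integer
    point [1 + n + m]. *)
Lemma stirling_error_vanishes (x : R) : 1 <= x ->
  is_lim_seq (fun n => stirling_error (x + INR n)) 0.
Proof.
  intros Hx; destruct (nfloor_ex (x - 1) ltac:(lra)) as [m Hm].
  set (s := x - 1 - INR m).
  apply is_lim_seq_ext with (fun n => stirling_error (1 + INR (n + m)) +
    (stirling_error (1 + INR (n + m) + s) - stirling_error (1 + INR (n + m)))).
  { intros n; rewrite plus_INR.
    replace (1 + (INR n + INR m) + s) with (x + INR n) by (unfold s; ring); ring. }
  replace (Finite 0) with (Finite (0 + 0)) by (f_equal; ring).
  apply is_lim_seq_plus'.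
  - apply (is_lim_seq_incr_n (fun n => stirling_error (1 + INR n))), stirling_error_nat_vanishes.
  - apply vanishing_of_inv_bound with 2 (1 + INR m); intros n.
    rewrite plus_INR; assert (Hn := pos_INR n); assert (Hm' := pos_INR m).
    replace (1 + INR m + INR n) with (1 + (INR n + INR m)) by ring.
    apply stirling_error_near; [|unfold s]; lra.
Qed.

(** * Numerical bounds on [exp 4] and [PI] *)

(* The partial sums of [exp (-1)] are [derangements n / n!]; integers are used so
   that they can be evaluated. *)
Fixpoint derangements (n : nat) : Z :=
  match n with
  | O => 1
  | S m => Z.of_nat n * derangements m + (if Nat.even n then 1 else -1)
  end.

Fixpoint zfact (n : nat) : Z :=
  match n with O => 1 | S m => Z.of_nat n * zfact m end.

Lemma zfact_fact (n : nat) : IZR (zfact n) = INR (fact n).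
Proof.
  induction n as [|n IH]; [easy|].
  change (zfact (S n)) with (Z.of_nat (S n) * zfact n)%Z.
  rewrite mult_IZR, IH, fact_simpl, mult_INR, <- INR_IZR_INZ; easy.
Qed.

Lemma derangements_sum (n : nat) :
  sum_f_R0 (tg_alt (fun k => / INR (fact k))) n = IZR (derangements n) / IZR (zfact n).
Proof.
  induction n as [|n IH]; [unfold tg_alt; simpl; field|].
  rewrite tech5, IH; unfold tg_alt; rewrite zfact_fact.
  change (derangements (S n)) with
    (Z.of_nat (S n) * derangements n + (if Nat.even (S n) then 1 else -1))%Z.
  rewrite plus_IZR, mult_IZR, <- INR_IZR_INZ, zfact_fact, fact_simpl, mult_INR.
  assert (H1 := INR_fact_neq_0 n); assert (H2 := not_0_INR (S n) ltac:(lia)).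
  assert (E : (-1) ^ S n = IZR (if Nat.even (S n) then 1 else -1)).
  { destruct (Nat.even (S n)) eqn:Ev.
    - apply Nat.even_spec in Ev; destruct Ev as [k ->]; apply pow_1_even.
    - assert (Ov : Nat.odd (S n) = true) by (unfold Nat.odd; now rewrite Ev).
      apply Nat.odd_spec in Ov; destruct Ov as [k Hk]; rewrite Hk.
      replace (2 * k + 1)%nat with (S (2 * k)) by lia; apply pow_1_odd. }
  rewrite E; field; auto.
Qed.

(** Consecutive partial sums of an alternating series with decreasing terms enclose its sum. *)
Lemma exp_m1_bounds (n : nat) :
  IZR (derangements (S (2 * n))) / IZR (zfact (S (2 * n))) <= exp (-1) <=
  IZR (derangements (2 * n)) / IZR (zfact (2 * n)).
Proof.
  rewrite <- !derangements_sum.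
  apply (alternated_series_ineq (fun k => / INR (fact k)) (exp (-1)) n).
  - intros k; apply Rinv_le_contravar; [apply INR_fact_lt_0|].
    apply le_INR, fact_le; lia.
  - assert (H := cv_speed_pow_fact 1).
    apply Un_cv_ext with (2 := H); intros k; rewrite pow1; unfold Rdiv; ring.
  - assert (H := proj2_sig (exist_exp (-1))).
    change (exp_in (-1) (exp (-1))) in H.
    apply Un_cv_ext with (2 := H); intros k; apply sum_eq; intros i _.
    unfold tg_alt; ring.
Qed.

Lemma exp_4_bounds : 54.5981500331441 < exp 4 < 54.5981500331444.
Proof.
  (* The sums of order 18 and 19 differ by [1 / 19!], less than [10^(-17)]. *)
  assert (H := exp_m1_bounds 9).
  assert (E : exp 4 = / exp (-1) ^ 4).
  { replace 4 with (- (-1 + -1 + -1 + -1)) by lra.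
    rewrite exp_Ropp, !exp_plus; f_equal; ring. }
  rewrite E.
  cbv -[IZR Rle Rdiv Rmult Rinv exp] in H.
  set (z := exp (-1)) in *.
  assert (0.36787944117144230 < z < 0.36787944117144237) by lra.
  split.
  - apply Rlt_le_trans with (/ 0.36787944117144237 ^ 4); [lra|].
    apply Rinv_le_contravar; [apply pow_lt|apply pow_incr]; lra.
  - apply Rle_lt_trans with (/ 0.36787944117144230 ^ 4); [|lra].
    apply Rinv_le_contravar; [apply pow_lt|apply pow_incr]; lra.
Qed.

Lemma PI_bounds : 3.14159265358979 < PI < 3.1415926535898.
Proof.
  (* Alternating sums for [PI / 4 = 2 atan (1/3) + atan (1/7)], up to the terms of index 14 and
     15. *)
  assert (H := PI_2_3_7_ineq 7).
  cbn [sum_f_R0 Nat.mul Nat.add] in H.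
  unfold tg_alt, PI_2_3_7_tg, Ratan_seq in H.
  rewrite !INR_IZR_INZ in H.
  cbn -[Rmult Rplus Rdiv Rinv Rminus IZR] in H.
  lra.
Qed.

(** * Comparison with the correction term *)

Definition quadratic (a x : R) : R := x ^ 2 + x / 3 + a.

(** This is [q_a]. The term [- / 2 * ln x] compensates the [/ 2 * ln x] already in
    [stirling_exponent]. *)
Definition correction (a x : R) : R := / 4 * ln (quadratic a x) - / 2 * ln x.

Definition correction_D2 (a x : R) : R :=
  / 4 * ((2 * quadratic a x - (2 * x + / 3) ^ 2) / quadratic a x ^ 2 + 2 / x ^ 2).

Lemma quadratic_gt0 (a x : R) : - 4 / 3 < a -> 1 <= x -> 0 < quadratic a x.
Proof. unfold quadratic; nra. Qed.

Lemma correction_has_D2 (a : R) : - 4 / 3 < a ->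
  has_D2 (correction a) (correction_D2 a).
Proof.
  intros Ha; exists (fun x => / 4 * ((2 * x + / 3) / quadratic a x) - / 2 / x).
  intros x Hx; assert (HQ := quadratic_gt0 a x Ha Hx).
  unfold correction, correction_D2, quadratic in *; split.
  - auto_derive; [simpl in HQ; repeat split; lra|field; simpl in *; lra].
  - auto_derive; [simpl in HQ; repeat split; lra|field; simpl in *; lra].
Qed.

Lemma stirling_approx_exp (a x : R) : 0 < x ->
  stirling_approx a x = exp (stirling_exponent x + correction a x).
Proof.
  intros Hx; assert (HPI := PI_RGT_0).
  unfold stirling_approx, stirling_exponent, correction, quadratic, Rpower.
  rewrite <- Rpower_sqrt by lra; unfold Rpower; rewrite <- !exp_plus.
  f_equal; field.
Qed.

Lemma Gamma_exp (x : R) : 0 < x ->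
  Gamma (x + 1) = exp (stirling_exponent x + stirling_error x).
Proof.
  intros Hx; unfold stirling_error.
  replace (stirling_exponent x + (ln (Gamma (x + 1)) - stirling_exponent x))
    with (ln (Gamma (x + 1))) by ring.
  symmetry; apply exp_ln, gamma_integral, Hx.
Qed.

Lemma stirling_approx_le_iff (a x : R) : 0 < x ->
  stirling_approx a x <= Gamma (x + 1) <-> correction a x <= stirling_error x.
Proof.
  intros Hx; rewrite stirling_approx_exp, Gamma_exp by exact Hx; split; intros H.
  - destruct H as [H|H]; [apply exp_lt_inv in H|apply exp_inv in H]; lra.
  - destruct H as [H|H]; [apply Rlt_le, exp_increasing; lra|rewrite H; lra].
Qed.

Lemma stirling_approx_gt_iff (a x : R) : 0 < x ->
  Gamma (x + 1) < stirling_approx a x <-> stirling_error x < correction a x.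
Proof.
  intros Hx; rewrite stirling_approx_exp, Gamma_exp by exact Hx; split; intros H.
  - apply exp_lt_inv in H; lra.
  - apply exp_increasing; lra.
Qed.

(** [quadratic a y] lies between [y ^ 2] and [y ^ 2 + 2 * y], so four times the correction lies
    between 0 and [2 / y]. *)
Lemma correction_vanishes (a x : R) : 0 <= a <= 1 -> 1 <= x ->
  is_lim_seq (fun n => correction a (x + INR n)) 0.
Proof.
  intros Ha Hx; apply vanishing_of_inv_bound with 1 x; intros n.
  assert (Hn := pos_INR n); set (y := x + INR n); assert (Hy : 1 <= y) by (unfold y; lra).
  assert (HQ : y ^ 2 <= quadratic a y <= y ^ 2 + 2 * y) by (unfold quadratic; lra).
  assert (E : correction a y = / 4 * (ln (quadratic a y) - ln (y ^ 2))).
  { unfold correction; simpl; rewrite Rmult_1_r, ln_mult by lra; field. }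
  assert (Hy2 : 0 < y ^ 2) by (apply pow_lt; lra).
  assert (H1 := ln_le _ _ Hy2 (proj1 HQ)).
  assert (H2 := ln_diff_le (y ^ 2) (quadratic a y) Hy2 ltac:(lra)).
  assert (H3 : (quadratic a y - y ^ 2) / y ^ 2 <= 2 * / y).
  { replace (2 * / y) with (2 * y / y ^ 2) by (field; lra).
    apply Rmult_le_compat_r; [apply Rlt_le, Rinv_0_lt_compat|]; lra. }
  assert (0 < / y) by (apply Rinv_0_lt_compat; lra).
  rewrite E; apply Rabs_le; lra.
Qed.

(** * The upper inequality *)

Lemma upper_D2_gt0 (x : R) : 1 <= x ->
  0 < correction_D2 (1 / 18) x - correction_D2 (1 / 18) (x + 1)
      - / (2 * x ^ 2 * (x + 1) ^ 2).
Proof.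
  intros Hx; set (y := x - 1).
  replace x with (1 + y) by (unfold y; ring).
  assert (Hy : 0 <= y) by (unfold y; lra).
  assert (H1 := quadratic_gt0 (1 / 18) (1 + y) ltac:(lra) ltac:(lra)).
  assert (H2 := quadratic_gt0 (1 / 18) (1 + y + 1) ltac:(lra) ltac:(lra)).
  (* Over the common denominator, expanding at [x = 1] leaves a numerator with positive coefficients
     only. *)
  replace (correction_D2 (1 / 18) (1 + y) - correction_D2 (1 / 18) (1 + y + 1)
      - / (2 * (1 + y) ^ 2 * (1 + y + 1) ^ 2)) with
    ((163225 / 26244 + 642985 / 26244 * y + 85265 / 2187 * y ^ 2
      + 23315 / 729 * y ^ 3 + 3457 / 243 * y ^ 4 + 263 / 81 * y ^ 5 + 8 / 27 * y ^ 6)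
     / (4 * quadratic (1 / 18) (1 + y) ^ 2 * quadratic (1 / 18) (1 + y + 1) ^ 2
        * (1 + y) ^ 2 * (1 + y + 1) ^ 2)).
  - apply Rdiv_lt_0_compat.
    + assert (0 <= y ^ 2) by (apply pow_le; lra); assert (0 <= y ^ 3) by (apply pow_le; lra).
      assert (0 <= y ^ 4) by (apply pow_le; lra); assert (0 <= y ^ 5) by (apply pow_le; lra).
      assert (0 <= y ^ 6) by (apply pow_le; lra); lra.
    + repeat apply Rmult_lt_0_compat; try apply pow_lt; lra.
  - unfold correction_D2, quadratic in *; field; lra.
Qed.

Lemma stirling_error_lt_correction (x : R) : 1 <= x ->
  stirling_error x < correction (1 / 18) x.
Proof.
  intros Hx; apply Rlt_0_minus.
  apply (vanishing_increment_D2_gt0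
    (fun y => correction (1 / 18) y - stirling_error y) _ x Hx) with (2 := upper_D2_gt0).
  - assert (Hc := correction_has_D2 (1 / 18) ltac:(lra)).
    apply has_D2_ext with (3 := has_D2_minus _ _ _ _
      (has_D2_minus _ _ _ _ Hc (has_D2_shift _ _ Hc)) error_step_D2); [easy|].
    intros y Hy; rewrite <- stirling_error_step by exact Hy; ring.
  - intros y Hy; replace (Finite 0) with (Finite (0 - 0)) by (f_equal; ring).
    apply is_lim_seq_minus'; [apply correction_vanishes; lra|now apply stirling_error_vanishes].
Qed.

(** * Lower bound by the first two terms of the Stirling series *)

Definition stirling_series (x : R) : R := / 12 / x - / 360 / x ^ 3.

Lemma stirling_series_D2 :
  has_D2 stirling_series (fun x => / 6 / x ^ 3 - / 30 / x ^ 5).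
Proof.
  exists (fun x => - / 12 / x ^ 2 + / 120 / x ^ 4).
  intros x Hx; assert (0 < x) by lra; unfold stirling_series; split.
  - auto_derive; [repeat split; try lra; apply Rgt_not_eq, (pow_lt x 3); lra|field; lra].
  - auto_derive; [repeat split; try lra; apply Rgt_not_eq;
      [apply (pow_lt x 2)|apply (pow_lt x 4)]; lra|field; lra].
Qed.

Lemma stirling_series_vanishes (x : R) : 1 <= x ->
  is_lim_seq (fun n => stirling_series (x + INR n)) 0.
Proof.
  intros Hx; apply vanishing_of_inv_bound with 1 x; intros n.
  assert (Hn := pos_INR n); set (y := x + INR n); assert (Hy : 1 <= y) by (unfold y; lra).
  assert (0 < / y) by (apply Rinv_0_lt_compat; lra).
  assert (/ y <= 1) by (rewrite <- Rinv_1; apply Rinv_le_contravar; lra).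
  replace (stirling_series y) with (/ 12 * / y - / 360 * (/ y * (/ y * / y)))
    by (unfold stirling_series; field; lra).
  assert (0 <= / y * / y <= 1) by nra.
  apply Rabs_le; nra.
Qed.

Lemma stirling_error_gt_series (x : R) : 1 <= x -> stirling_series x < stirling_error x.
Proof.
  intros Hx; apply Rlt_0_minus.
  (* The quotient is the simplified second derivative of the increment. *)
  apply (vanishing_increment_D2_gt0 (fun y => stirling_error y - stirling_series y)
    (fun y => (5 * y ^ 2 + 5 * y + 1) / (30 * y ^ 5 * (y + 1) ^ 5)) x Hx).
  - apply has_D2_ext with (3 := has_D2_minus _ _ _ _ error_step_D2
      (has_D2_minus _ _ _ _ stirling_series_D2 (has_D2_shift _ _ stirling_series_D2))).
    + intros y Hy; field; lra.
    + intros y Hy; rewrite <- stirling_error_step by exact Hy; ring.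
  - intros y Hy; apply Rdiv_lt_0_compat; [nra|].
    repeat apply Rmult_lt_0_compat; try apply pow_lt; lra.
  - intros y Hy; replace (Finite 0) with (Finite (0 - 0)) by (f_equal; ring).
    apply is_lim_seq_minus'; [now apply stirling_error_vanishes|].
    now apply stirling_series_vanishes.
Qed.

Lemma exp_ge_quadratic (v : R) : 0 <= v -> 1 + v + v ^ 2 / 2 <= exp v.
Proof.
  intros Hv; apply Rle_trans with (2 := exp_ge_taylor v 2 Hv); simpl; lra.
Qed.

Lemma exp_ge_cubic (v : R) : 0 <= v -> 1 + v + v ^ 2 / 2 + v ^ 3 / 6 <= exp v.
Proof.
  intros Hv; apply Rle_trans with (2 := exp_ge_taylor v 3 Hv); simpl; lra.
Qed.

(** With [t = 1 / x], comparing [correction] with [stirling_series] becomes comparing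
    [1 + t/3 + a t^2] with [exp (t/3 - t^3/90)]. *)
Lemma four_correction (a x : R) : 0 < x -> 0 < quadratic a x ->
  4 * correction a x = ln (1 + / x / 3 + a * (/ x) ^ 2).
Proof.
  intros Hx HQ; replace (1 + / x / 3 + a * (/ x) ^ 2) with (quadratic a x / (x * x))
    by (unfold quadratic; field; lra).
  unfold correction; rewrite ln_quotient, ln_mult by nra; field.
Qed.

Lemma four_stirling_series (x : R) : 0 < x ->
  4 * stirling_series x = / x / 3 - (/ x) ^ 3 / 90.
Proof. intros Hx; unfold stirling_series; field; lra. Qed.

Lemma four_stirling_series_ge0 (x : R) : 1 <= x -> 0 <= / x / 3 - (/ x) ^ 3 / 90.
Proof.
  intros Hx; assert (0 < / x) by (apply Rinv_0_lt_compat; lra).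
  assert (/ x <= 1) by (rewrite <- Rinv_1; apply Rinv_le_contravar; lra).
  simpl; nra.
Qed.

(** * Optimality of the upper constant *)

Lemma upper_bound_constant (a : R) : upper_bound_holds a -> 1 / 18 <= a.
Proof.
  intros H; destruct (Rle_lt_dec (1 / 18) a) as [h|h]; [exact h|exfalso].
  set (d := 1 / 18 - a); assert (Hd : 0 < d) by (unfold d; lra).
  assert (Hid : 0 < / d) by (apply Rinv_0_lt_compat; lra).
  assert (Habs := Rabs_pos a); assert (Ha := Rle_abs (- a)); rewrite Rabs_Ropp in Ha.
  (* [Rabs a] makes the quadratic positive, and [/ d] makes [t = / x] at most [d]. *)
  set (x := 1 + Rabs a + / d); assert (Hx : 1 <= x) by (unfold x; lra).
  assert (HQ : 0 < quadratic a x) by (unfold quadratic, x in *; nra).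
  specialize (H x Hx); apply stirling_approx_gt_iff in H; [|lra].
  assert (HS := stirling_error_gt_series x Hx).
  assert (HL : 4 * stirling_series x < 4 * correction a x) by lra.
  rewrite four_correction, four_stirling_series in HL by lra.
  assert (Hv := four_stirling_series_ge0 x Hx).
  assert (Hexp := exp_ge_quadratic _ Hv).
  set (t := / x) in *.
  assert (Ht : 0 < t) by (apply Rinv_0_lt_compat; lra).
  assert (Ht1 : t <= 1) by (unfold t; rewrite <- Rinv_1; apply Rinv_le_contravar; lra).
  assert (Htd : t <= d).
  { unfold t; rewrite <- (Rinv_inv d); apply Rinv_le_contravar; unfold x; lra. }
  assert (HP : 0 < 1 + t / 3 + a * t ^ 2).
  { replace (1 + t / 3 + a * t ^ 2) with (quadratic a x * (t * t))
      by (unfold quadratic, t; field; lra).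
    apply Rmult_lt_0_compat; [exact HQ|nra]. }
  apply exp_increasing in HL; rewrite exp_ln in HL by exact HP.
  (* The coefficients of [t ^ 2] are [1 / 18] on the left and [a = 1 / 18 - d] on the right; the
     other terms of the left side are too small to make up for [d]. *)
  assert (Hlt : (t / 3 - t ^ 3 / 90) + (t / 3 - t ^ 3 / 90) ^ 2 / 2 < t / 3 + a * t ^ 2) by lra.
  replace a with (1 / 18 - d) in Hlt by (unfold d; ring).
  assert (H6 : 0 <= t ^ 6) by (apply pow_le; lra).
  assert (Hlt2 : 0 < t ^ 2 * (t / 90 + t ^ 2 / 270 - d)) by lra.
  assert (Ht2 : 0 < t ^ 2) by (apply pow_lt, Ht).
  assert (t / 90 + t ^ 2 / 270 - d <= 0) by (simpl; nra).
  nra.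
Qed.

(** * The lower constant and the lower inequality *)

Lemma a_lower_bounds : 0.049653963176 <= a_lower < 0.049653963177.
Proof.
  assert (HP := PI_bounds); assert (HE := exp_4_bounds); unfold a_lower.
  assert (HP2 : 3.14159265358979 ^ 2 <= PI ^ 2 <= 3.1415926535898 ^ 2)
    by (split; apply pow_incr; lra).
  assert (HP0 : 0 < 4 * PI ^ 2) by lra.
  split.
  (* Here and below, the required digits plus [4 / 3], rounded inwards. *)
  - enough (1.382987296509334 <= exp 4 / (4 * PI ^ 2)) by lra.
    apply (Rle_div_r _ (exp 4) (4 * PI ^ 2)); lra.
  - enough (exp 4 / (4 * PI ^ 2) < 1.38298729651032) by lra.
    apply (Rlt_div_l (exp 4) _ (4 * PI ^ 2)); lra.
Qed.

(** The origin of [a_lower]: it makes the quadratic at 1 equal to [exp 4 / (2 PI)^2], that is, it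
    gives equality at [x = 1]. *)
Lemma correction_a_lower_1 : correction a_lower 1 = stirling_error 1.
Proof.
  assert (HPI := PI_RGT_0); assert (HE := exp_pos 4).
  unfold correction, stirling_error, stirling_exponent, quadratic, a_lower.
  rewrite Gamma_2, ln_1.
  replace (1 ^ 2 + 1 / 3 + (exp 4 / (4 * PI ^ 2) - 4 / 3))
    with (exp 4 / ((2 * PI) * (2 * PI))) by (field; lra).
  rewrite ln_quotient, ln_exp, (ln_mult (2 * PI)) by nra; field.
Qed.

(** The point [x = 1] decides, since the correction there increases with [a]. The case
    [a <= - 4 / 3], where the base at 1 is not positive, is split off and follows from
    [a_lower > 0]. *)
Lemma lower_bound_constant (a : R) : lower_bound_holds a -> a <= a_lower.
Proof.
  intros H; assert (Hb := a_lower_bounds).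
  destruct (Rle_lt_dec a (- 4 / 3)) as [h|h]; [lra|].
  specialize (H 1 ltac:(lra)); apply stirling_approx_le_iff in H; [|lra].
  rewrite <- correction_a_lower_1 in H; unfold correction, quadratic in H.
  destruct (Rle_lt_dec a a_lower) as [h'|h']; [exact h'|exfalso].
  assert (ln (1 ^ 2 + 1 / 3 + a_lower) < ln (1 ^ 2 + 1 / 3 + a))
    by (apply ln_increasing; lra).
  lra.
Qed.

(* With [t = 1 / x], [exp (t/3 - t^3/90) >= 1 + t/3 + a t^2] by a cubic Taylor
   bound; 0.327 is below [1/3 - t^2/90] for [t <= 5/7]. *)
Lemma correction_le_series (a x : R) : 0 < a < 0.0497 -> 7 / 5 <= x ->
  correction a x <= stirling_series x.
Proof.
  intros Ha Hx.
  assert (HQ := quadratic_gt0 a x ltac:(lra) ltac:(lra)).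
  assert (Hv := four_stirling_series_ge0 x ltac:(lra)).
  enough (4 * correction a x <= 4 * stirling_series x) by lra.
  rewrite four_correction, four_stirling_series by lra.
  set (t := / x) in *.
  assert (Ht : 0 < t) by (apply Rinv_0_lt_compat; lra).
  assert (Ht1 : t <= 5 / 7).
  { unfold t; replace (5 / 7) with (/ (7 / 5)) by field; apply Rinv_le_contravar; lra. }
  set (v := t / 3 - t ^ 3 / 90) in *.
  rewrite <- (ln_exp v); apply ln_le; [simpl; nra|].
  apply Rle_trans with (2 := exp_ge_cubic v Hv).
  assert (Ht2 : 0 < t * t) by nra.
  assert (Hv3 : (t * (0.327)) ^ 3 <= v ^ 3).
  { apply pow_incr; split; [lra|]; unfold v.
    replace (t / 3 - t ^ 3 / 90) with (t * (1 / 3 - t * t / 90)) by field.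
    apply Rmult_le_compat_l; [lra|nra]. }
  assert (H6 : 0 <= t ^ 6) by (apply pow_le; lra).
  assert (E : 1 + v + v ^ 2 / 2 =
    1 + t / 3 + t * t * (1 / 18 - t / 90 - t * t / 270) + t ^ 6 / 16200)
    by (unfold v; field).
  (* [0.034965783] is [0.327 ^ 3]. *)
  replace ((t * 0.327) ^ 3) with (t * t * (t * 0.034965783)) in Hv3 by lra.
  enough (0 <= t * t * (1 / 18 - t / 90 - t * t / 270 + t * 0.034965783 / 6 - a))
    by (simpl; lra).
  apply Rmult_le_pos; nra.
Qed.

(** This is the second derivative of [correction a x - error_step x - 1 / (12 (x + 1))], the
    explicit part of [correction - stirling_error]. *)
Lemma lower_D2_gt0 (a x : R) : 0.0496 < a < 0.0497 -> 1 <= x <= 7 / 5 ->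
  0 < correction_D2 a x - / (2 * x ^ 2 * (x + 1) ^ 2) - / 6 / (x + 1) ^ 3.
Proof.
  intros Ha Hx.
  assert (HQ := quadratic_gt0 a x ltac:(lra) ltac:(lra)).
  set (N := 3 * (2 * quadratic a x - (2 * x + / 3) ^ 2) * x ^ 2 * (x + 1) ^ 3
    + 6 * quadratic a x ^ 2 * (x + 1) ^ 3 - 6 * quadratic a x ^ 2 * (x + 1)
    - 2 * quadratic a x ^ 2 * x ^ 2).
  replace (correction_D2 a x - / (2 * x ^ 2 * (x + 1) ^ 2) - / 6 / (x + 1) ^ 3) with
    (N / (12 * quadratic a x ^ 2 * x ^ 2 * (x + 1) ^ 3))
    by (unfold N, correction_D2; field; lra).
  apply Rdiv_lt_0_compat.
  2: repeat apply Rmult_lt_0_compat; try apply pow_lt; lra.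
  (* Both variables are nonnegative, as [31 / 625 = 0.0496]. In the expansion only the part free of
     [e] has negative coefficients, and [y <= 2 / 5] keeps it positive. *)
  set (y := x - 1); set (e := a - 31 / 625).
  assert (Hy : 0 <= y <= 2 / 5) by (unfold y; lra).
  assert (He : 0 <= e) by (unfold e; lra).
  assert (E : N = 2599066 / 3515625 + y * (3516238 / 3515625 - 1234478 / 1171875 * y
      - 8039981 / 3515625 * y ^ 2 - 6074 / 5625 * y ^ 3 - 67 / 625 * y ^ 4)
    + e * (266324 / 1875 + 311344 / 625 * y + 424608 / 625 * y ^ 2
      + 842366 / 1875 * y ^ 3 + 144 * y ^ 4 + 18 * y ^ 5)
    + e ^ 2 * (34 + 62 * y + 34 * y ^ 2 + 6 * y ^ 3))
    by (unfold N, quadratic, y, e; field).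
  assert (P2 : 0 <= y ^ 2 <= (2 / 5) ^ 2) by (split; [apply pow_le|apply pow_incr]; lra).
  assert (P3 : 0 <= y ^ 3 <= (2 / 5) ^ 3) by (split; [apply pow_le|apply pow_incr]; lra).
  assert (P4 : 0 <= y ^ 4 <= (2 / 5) ^ 4) by (split; [apply pow_le|apply pow_incr]; lra).
  assert (P5 : 0 <= y ^ 5) by (apply pow_le; lra).
  rewrite E; apply Rplus_lt_le_0_compat; [apply Rplus_lt_le_0_compat|].
  - apply Rplus_lt_le_0_compat; [lra|apply Rmult_le_pos; lra].
  - apply Rmult_le_pos; lra.
  - apply Rmult_le_pos; [apply pow_le|]; lra.
Qed.

Lemma correction_le_stirling_error_near_1 (x : R) : 1 < x < 7 / 5 ->
  correction a_lower x <= stirling_error x.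
Proof.
  intros Hx; assert (Ha := a_lower_bounds).
  assert (Hc := correction_has_D2 a_lower ltac:(lra)).
  destruct (has_D2_minus _ _ _ _ (has_D2_minus _ _ _ _ Hc error_step_D2)
    (has_D2_shift _ _ (inv_D2 (/ 12)))) as [K1 HK].
  assert (HchordK := strictly_convex_chord _ K1 _ 1 x (7 / 5) Hx
    ltac:(intros y Hy; apply (HK y); lra) ltac:(intros y Hy; apply (HK y); lra)
    ltac:(intros y Hy; cbv beta; replace (2 * / 12 / (y + 1) ^ 3) with (/ 6 / (y + 1) ^ 3)
      by (field; lra); apply lower_D2_gt0; lra)).
  cbv beta in HchordK.
  assert (Hg : has_D2 (fun y => (/ 12 / y - stirling_error y)
    - (/ 12 / (y + 1) - stirling_error (y + 1))) (fun x => / (6 * (x * (x + 1)) ^ 3))).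
  { apply has_D2_ext with (3 := step_gap_D2); [easy|].
    intros y Hy; unfold step_gap; rewrite <- stirling_error_step by exact Hy; ring. }
  (* The remaining part of [correction - stirling_error] is [1 / (12 y) - stirling_error y] at
     [y = x + 1], convex by its increments [step_gap]; hence the shifted points. *)
  assert (Hchordg := vanishing_increment_D2_chord
    (fun y => / 12 / y - stirling_error y) _ (1 + 1) (x + 1) (7 / 5 + 1)
    ltac:(lra) ltac:(lra) Hg step_gap_D2_gt0).
  cbv beta in Hchordg.
  assert (E : forall y, 0 < y -> error_step y = stirling_error y - stirling_error (y + 1))
    by (intros y Hy; symmetry; apply stirling_error_step, Hy).
  rewrite !E in HchordK by lra.
  assert (H1 := correction_a_lower_1).
  assert (H2 := correction_le_series a_lower (7 / 5) ltac:(lra) ltac:(lra)).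
  assert (H3 := stirling_error_gt_series (7 / 5) ltac:(lra)).
  assert (H4 : 0 <= (x - 1) * (stirling_error (7 / 5) - correction a_lower (7 / 5)))
    by (apply Rmult_le_pos; lra).
  rewrite H1 in HchordK.
  (* The two chord inequalities add up to one for [correction - stirling_error], which is 0 at 1 and
     nonpositive at [7 / 5]. *)
  enough (0 <= (7 / 5 - 1) * (stirling_error x - correction a_lower x)) by lra.
  assert (Hlim : forall y, 1 <= y ->
    is_lim_seq (fun n => / 12 / (y + INR n) - stirling_error (y + INR n)) 0).
  { intros y Hy; replace (Finite 0) with (Finite (0 - 0)) by (f_equal; ring).
    apply is_lim_seq_minus'; [apply inv_vanishes|now apply stirling_error_vanishes]. }
  specialize (Hchordg Hlim).
  set (g1 := / 12 / (1 + 1)) in *; set (gx := / 12 / (x + 1)) in *.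
  set (g7 := / 12 / (7 / 5 + 1)) in *.
  lra.
Qed.

Lemma correction_le_stirling_error (x : R) : 1 <= x ->
  correction a_lower x <= stirling_error x.
Proof.
  intros Hx; assert (Ha := a_lower_bounds).
  destruct (Rle_lt_dec (7 / 5) x) as [h|h].
  - apply Rle_trans with (1 := correction_le_series a_lower x ltac:(lra) h).
    now apply Rlt_le, stirling_error_gt_series.
  - destruct Hx as [Hx|<-]; [|rewrite correction_a_lower_1; lra].
    apply correction_le_stirling_error_near_1; lra.
Qed.

Theorem theorem2p2 :
  (forall x : R, 1 <= x ->
     stirling_approx a_lower x <= Gamma (x + 1) < stirling_approx a_upper x) /\
  is_largest lower_bound_holds a_lower /\
  is_smallest upper_bound_holds a_upper /\
  0.049653963176 <= a_lower < 0.049653963177.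
Proof.
  assert (L : lower_bound_holds a_lower).
  { intros x Hx; apply stirling_approx_le_iff; [lra|].
    now apply correction_le_stirling_error. }
  assert (U : upper_bound_holds a_upper).
  { intros x Hx; apply stirling_approx_gt_iff; [lra|].
    now apply stirling_error_lt_correction. }
  split; [now auto|].
  split; [exact (conj L lower_bound_constant)|].
  split; [exact (conj U upper_bound_constant)|exact a_lower_bounds].
Qed.
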